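(* Let $d\ge 1$ and let $\mathcal{B}_d$ be the set of all boxes $\prod_{i=1}^d[a_i,b_i]\subseteq\mathbb{R}^d$ with $a_i\le b_i$ integers. The $\mathbb{C}$-algebra homomorphism $\phi:\mathbb{C}[x_1^{\pm1},\dots,x_d^{\pm1},y_1^{\pm1},\dots,y_d^{\pm1}]\to M(\mathcal{B}_d)$ given by $\phi(x_i)=[\{\tilde e_i\}]$ and $\phi(y_i)=[\pi_i([0,1]^d)]$ is surjective with kernel $\ker(\phi)=((y_1-1)(y_1-x_1),\dots,(y_d-1)(y_d-x_d))$, and so $$M(\mathcal{B}_d)\cong \mathbb{C}[x_1^{\pm1},\dots,x_d^{\pm1},y_1^{\pm1},\dots,y_d^{\pm1}]/((y_1-1)(y_1-x_1),\dots,(y_d-1)(y_d-x_d)).$$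
   Context: For $S\subseteq W=\mathbb{R}^d$, $[S]:W\to\mathbb{C}$ denotes its indicator function. Let $M(\mathcal{P}(W))$ be the complex vector space of functions on $W$ spanned by the indicator functions of closed convex polyhedra; it is a commutative $\mathbb{C}$-algebra with the well-defined bilinear product determined by $[A]\cdot[B]=[A+B]$ (Minkowski sum) for nonempty closed convex polyhedra $A,B$, with unit $[\{0\}]$. For a set $\mathcal{D}$ of closed convex polyhedra, the Minkowski ring $M(\mathcal{D})$ is the unital $\mathbb{C}$-subalgebra generated by all $[P]$, $P\in\mathcal{D}$. For a nonempty convex polytope $P$, $[P]$ is invertible in $M(\mathcal{P}(W))$, with $[P]^{-1}=(-1)^{\dim P}[-\mathring{P}]$, $\mathring P$ the relative interior. $\tilde e_i$ is the $i$-th standard basis vector of $\mathbb{R}^d$ and $\pi_i:\mathbb{R}^d\to\mathbb{R}^d$ is $\tilde x\mapsto x_i\tilde e_i$. *)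

(* Defs.v *)
From HB Require Import structures.
From mathcomp Require Import all_boot all_order all_algebra.
From mathcomp Require Import finmap.
From mathcomp Require Import boolp classical_sets functions reals numfun.
From mathcomp Require Import ring lra.
From mathcomp.multinomials Require Import monalg.
From mathcomp Require Import complex.

Set Implicit Arguments.
Unset Strict Implicit.
Unset Printing Implicit Defensive.

Import Order.TTheory GRing.Theory Num.Theory.
Local Open Scope classical_set_scope.
Local Open Scope ring_scope.

Section Polyhedra.
Variables (R : realFieldType).

(* The pair (f, b) stands for the closed half-space of all x with f x <= b. *)
Definition halfspace (V : lmodType R) : Type := ({scalar V} * R)%type.
HB.instance Definition _ (V : lmodType R) := gen_eqMixin (halfspace V).

Definition sat (V : lmodType R) (s : seq (halfspace V)) (x : V) : bool :=
  all (fun h : halfspace V => h.1 x <= h.2) s.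

Definition polyhedral (V : lmodType R) (A : set V) : Prop :=
  exists s : seq (halfspace V), A = [set x | sat s x].

Section Combinations.
Variables (V : lmodType R) (f g : {scalar V}) (a b : R).
Definition lincomb (x : V) : R := a * f x + b * g x.
Fact lincomb_linear : scalar lincomb.
Proof.
move=> k x y; rewrite /lincomb !linearP /=.
by rewrite !mulrDr !mulrA (mulrC a k) (mulrC b k) addrACA.
Qed.
HB.instance Definition _ :=
  GRing.isLinear.Build R V R *%R lincomb lincomb_linear.
Definition lincombL : {scalar V} := lincomb.
End Combinations.

Section Comp.
Variables (U V : lmodType R) (h : {linear U -> V}) (f : {scalar V}).
Definition fcomp (x : U) : R := f (h x).
Fact fcomp_linear : scalar fcomp.
Proof. by move=> k x y; rewrite /fcomp !linearP. Qed.
HB.instance Definition _ :=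
  GRing.isLinear.Build R U R *%R fcomp fcomp_linear.
Definition fcompL : {scalar U} := fcomp.
End Comp.

Lemma polyhedral_preim (U V : lmodType R) (h : {linear U -> V}) (c : V) (A : set V) :
  polyhedral A -> polyhedral [set x | A (h x + c)].
Proof.
case=> s ->; exists [seq (fcompL h p.1, p.2 - p.1 c) | p <- s].
apply/seteqP; split=> x; rewrite /= /sat all_map; apply: sub_all => p /=;
  by rewrite linearD /fcomp lerBrDr.
Qed.

Lemma polyhedralI (V : lmodType R) (A B : set V) :
  polyhedral A -> polyhedral B -> polyhedral (A `&` B).
Proof.
case=> s -> [t ->]; exists (s ++ t).
by apply/seteqP; split=> x; rewrite /= /sat all_cat => /andP.
Qed.

Lemma exists_between (l u : seq R) :
  (forall a b, a \in l -> b \in u -> a <= b) ->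
  exists t, all (fun a => a <= t) l && all (fun b => t <= b) u.
Proof.
have maxP (a : R) (s : seq R) :
    exists2 m, m \in a :: s & all (fun b => b <= m) (a :: s).
  elim: s a => [|b s IHs] a; first by exists a; rewrite /= ?lexx ?mem_head.
  have [m ms /andP[bm sm]] := IHs b.
  have [am|ma] := leP a m.
    by exists m; [rewrite in_cons ms orbT | rewrite /= am bm].
  exists a; first exact: mem_head.
  rewrite /= lexx (le_trans bm (ltW ma)) /=.
  by apply: sub_all sm => c cm; exact: le_trans (ltW ma).
have minP (a : R) (s : seq R) :
    exists m, all (fun b => m <= b) (a :: s).
  elim: s a => [|b s IHs] a; first by exists a; rewrite /= lexx.
  have [m /andP[bm sm]] := IHs b.
  exists (Order.min a m); rewrite /= ge_min lexx /= ge_min bm orbT /=.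
  by apply: sub_all sm => c cm; rewrite ge_min cm orbT.
case: l => [_|a l H].
  by case: u => [|b u]; [exists 0 | have [m] := minP b u; exists m].
have [m ml Hm] := maxP a l; exists m; rewrite Hm.
by apply/allP => b bu; exact: H.
Qed.

Lemma line_polyhedral (V : lmodType R) (v : V) (A : set V) :
  polyhedral A -> polyhedral [set x | exists t : R, A (x + t *: v)].
Proof.
case=> s ->.
pose zs := [seq h : halfspace V <- s | h.1 v == 0].
pose ps := [seq h : halfspace V <- s | 0 < h.1 v].
pose ns := [seq h : halfspace V <- s | h.1 v < 0].
exists (zs ++ [seq (lincombL h.1 k.1 (h.1 v)^-1 (- (k.1 v)^-1),
                    h.2 / h.1 v - k.2 / k.1 v) | h : halfspace V <- ps, k : halfspace V <- ns]).
have satE x t : sat s (x + t *: v) =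
  [&& sat zs x,
      all (fun a => a <= t) [seq (h.2 - h.1 x) / h.1 v | h : halfspace V <- ns]
    & all (fun b => t <= b) [seq (h.2 - h.1 x) / h.1 v | h : halfspace V <- ps]].
  rewrite /zs /ps /ns /sat !all_map !all_filter.
  elim: s {zs ps ns} => //= h s ->.
  rewrite linearD linearZ /=; have [h0|h0|->] := ltgtP (h.1 v) 0.
  - rewrite /= ler_ndivrMr // lerBrDl.
    by case: (_ <= _); rewrite ?andbF.
  - rewrite /= ler_pdivlMr // lerBrDl.
    by case: (_ <= _); rewrite ?andbF.
  - by rewrite mulr0 addr0 /= andbA.
have satc s1 s2 x : sat (s1 ++ s2) x = sat s1 x && sat s2 x.
  by rewrite /sat all_cat.
apply/seteqP; split=> x /=; rewrite satc.
  case=> t; rewrite satE => /and3P[-> /allP Hn /allP Hp] /=.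
  rewrite /sat; apply/allP => _ /allpairsPdep[h [k [hp kn ->]]] /=; rewrite /lincomb.
  have := le_trans (Hn _ (map_f _ kn)) (Hp _ (map_f _ hp)).
  by rewrite !mulrBl; lra.
case/andP=> Hz /allP Hc.
have [|t Ht] := @exists_between [seq (h.2 - h.1 x) / h.1 v | h : halfspace V <- ns]
   [seq (h.2 - h.1 x) / h.1 v | h : halfspace V <- ps].
  move=> _ _ /mapP[k kn ->] /mapP[h hp ->].
  have := Hc _ (allpairs_f_dep _ hp kn); rewrite /= /lincomb !mulrBl.
  by lra.
by exists t; rewrite satE Hz.
Qed.

(* Alternating sum of F over the points of e :: s and over the midpoints of
   consecutive points: a combination of point evaluations which computes
   the Euler characteristic of every closed interval with endpoints among
   these points. *)
Fixpoint altsum (K : zmodType) (F : R -> K) (e : R) (s : seq R) : K :=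
  if s is e' :: s' then F e - F ((e + e') / 2) + altsum F e' s' else F e.

Lemma altsum_sum (K : zmodType) (I : Type) (r : seq I) (F : I -> R -> K) e s :
  altsum (fun t => \sum_(i <- r) F i t) e s = \sum_(i <- r) altsum (F i) e s.
Proof.
elim: s e => //= e' s IHs e; rewrite IHs -sumrB -big_split /=.
by [].
Qed.

Lemma altsumZ (K : nzRingType) (c : K) (F : R -> K) e s :
  altsum (fun t => c * F t) e s = c * altsum F e s.
Proof. by elim: s e => //= e' s IHs e; rewrite IHs mulrDr mulrBr. Qed.

Lemma altsum_eq0 (K : zmodType) (F : R -> K) e s :
  (forall t, F t = 0) -> altsum F e s = 0.
Proof. by move=> F0; elim: s e => /= [|e' s IHs] e; rewrite ?IHs !F0 ?subr0 ?addr0. Qed.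

Definition sat1 (s : seq (R * R)) (t : R) : bool :=
  all (fun h => h.1 * t <= h.2) s.

Lemma sat1_convex s a b t : a <= t -> t <= b -> sat1 s a -> sat1 s b -> sat1 s t.
Proof.
move=> at_ tb /allP sa /allP sb; apply/allP => h hs.
have := sa _ hs; have := sb _ hs.
have [h0|h0] := leP 0 h.1.
  by move=> H _; apply: le_trans H; exact: ler_wpM2l.
by move=> _ H; apply: le_trans H; rewrite ler_nM2l.
Qed.

Lemma altsum_interval (K : nzRingType) (s : seq (R * R)) (E : seq R) e l :
  (forall h, h \in s -> h.1 != 0 -> h.2 / h.1 \in E) ->
  sorted <%R (e :: l) ->
  (forall x, x \in E -> (x <= e) || (x \in l)) ->
  altsum (fun t => (sat1 s t)%:R : K) e l = (has (sat1 s) (e :: l))%:R.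
Proof.
move=> sE; elim: l e => [|e' l IHl] e /=; first by rewrite orbF.
move=> /andP[ee' el] El; rewrite IHl //; last first.
  move=> x /El; rewrite inE => /orP[xe|/orP[/eqP->|->]]; rewrite ?lexx ?orbT //.
  by rewrite (le_trans xe) // ltW.
have el' x : x \in l -> e' < x by move: x; exact/allP/(order_path_min lt_trans).
have m1 : e < (e + e') / 2 by lra.
have m2 : (e + e') / 2 < e' by lra.
have -> : sat1 s ((e + e') / 2) = sat1 s e && sat1 s e'.
  apply/idP/andP => [/allP Hm|[se se']]; last first.
    by apply: (sat1_convex (ltW m1) (ltW m2)).
  suff H h : h \in s -> h.1 * e <= h.2 /\ h.1 * e' <= h.2.
    by split; apply/allP => h /H[].
  move=> hs; have := Hm _ hs; have := sE _ hs.
  have [h0|h0|->] := ltgtP h.1 0; last by rewrite !mul0r.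
    rewrite ![h.1 * _]mulrC -!(ler_ndivrMr _ _ h0) => /(_ isT) /El /orP[xe _|].
      by split=> //; exact: le_trans (ltW ee').
    rewrite inE => /orP[/eqP->|/el'] ?; last by lra.
    by lra.
  rewrite ![h.1 * _]mulrC -!(ler_pdivlMr _ _ h0) => /(_ isT) /El /orP[xe ?|].
    by lra.
  rewrite inE => /orP[/eqP-> _|/el' ? _]; first by split=> //; exact: ltW.
  by split; lra.
have [se|nse] := boolP (sat1 s e) => /=; last first.
  by rewrite subr0 add0r.
have [se'|nse'] := boolP (sat1 s e') => /=.
  by rewrite subrr add0r.
suff -> : has (sat1 s) l = false by rewrite subr0 addr0.
apply/negbTE/hasPn => x xl; apply: contra nse'.
exact: sat1_convex (ltW ee') (ltW (el' _ xl)) se.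
Qed.

Lemma has_endpoint (s : seq (R * R)) (E : seq R) t :
  0 \in E -> (forall h, h \in s -> h.1 != 0 -> h.2 / h.1 \in E) ->
  sat1 s t -> has (sat1 s) E.
Proof.
move=> E0 sE st.
have [E1 | nE1] := boolP (has (fun x => (t <= x) && sat1 s x) E).
  by apply: sub_has E1 => x /andP[].
pose u := [seq h.2 / h.1 | h <- s & 0 < h.1].
pose l := [seq h.2 / h.1 | h <- s & h.1 < 0].
have lbP (v : seq R) : v != [::] -> exists2 m, m \in v & all (fun b => m <= b) v.
  elim: v => //= a v IHv _; case: v IHv => [|b v] IHv.
    by exists a; rewrite ?mem_head //= lexx.
  have [//|m mv Hm] := IHv; have [am|ma] := leP a m.
    exists a; first exact: mem_head.
    rewrite [all _ _]/= lexx /=; have := sub_all _ Hm; apply => c.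
    exact: le_trans.
  exists m; first by rewrite in_cons mv orbT.
  by move: Hm => /= ->; rewrite (ltW ma).
have ubP (v : seq R) : v != [::] -> exists2 m, m \in v & all (fun b => b <= m) v.
  move=> v0; have [|m mv /allP Hm] := lbP [seq - x | x <- v]; first by case: (v) v0.
  case/mapP: mv Hm => x xv -> Hm; exists x => //.
  by apply/allP => b bv; have := Hm _ (map_f _ bv); rewrite lerN2.
have stP h : h \in s -> h.1 * t <= h.2 by move/(allP st).
have [u0|/lbP[m mu /allP Hm]] := eqVneq u [::].
  have [l0|/ubP[m ml /allP Hm]] := eqVneq l [::].
    apply/hasP; exists 0 => //; apply/allP => h hs.
    have := stP _ hs.
    have [h0|h0|->] := ltgtP h.1 0; last by rewrite !mul0r.
      have : h.2 / h.1 \in l by apply/mapP; exists h; rewrite ?mem_filter ?h0.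
      by rewrite l0.
    have : h.2 / h.1 \in u by apply/mapP; exists h; rewrite ?mem_filter ?h0.
    by rewrite u0.
  apply/hasP; exists m.
    case/mapP: ml => h; rewrite mem_filter => /andP[h0 hs] ->.
    by apply: sE; rewrite // lt_eqF.
  apply/allP => h hs; have := stP _ hs.
  have [h0 _|h0|->] := ltgtP h.1 0; last by rewrite !mul0r.
    rewrite mulrC -ler_ndivrMr //; apply: Hm.
    by apply/mapP; exists h; rewrite ?mem_filter ?h0.
  have : h.2 / h.1 \in u by apply/mapP; exists h; rewrite ?mem_filter ?h0.
  by rewrite u0.
have tm : t <= m.
  case/mapP: mu => h; rewrite mem_filter => /andP[h0 hs] ->.
  by rewrite ler_pdivlMr // mulrC stP.
apply/hasP; exists m.
  case/mapP: mu => h; rewrite mem_filter => /andP[h0 hs] ->.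
  by apply: sE; rewrite // gt_eqF.
apply/allP => h hs; have := stP _ hs.
have [h0 H|h0 _|->] := ltgtP h.1 0; last by rewrite !mul0r.
  by apply: le_trans H; rewrite ler_nM2l.
rewrite mulrC -ler_pdivlMr //; apply: Hm.
by apply/mapP; exists h; rewrite ?mem_filter ?h0.
Qed.

End Polyhedra.

Section Relations.
Variables (R : realFieldType) (K : nzRingType).

Lemma line_euler (I : finType) (c : I -> K) (s : I -> seq (R * R)) :
  (forall t, \sum_i c i * (sat1 (s i) t)%:R = 0) ->
  \sum_i c i * (`[< exists t, sat1 (s i) t >])%:R = 0.
Proof.
move=> rel.
pose E0 := 0 :: flatten [seq [seq h.2 / h.1 | h <- s i] | i <- enum I].
pose E := sort <=%R (undup E0).
have inE0 x : (x \in E) = (x \in E0) by rewrite mem_sort mem_undup.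
have sE i h : h \in s i -> h.1 != 0 -> h.2 / h.1 \in E.
  move=> hs _; rewrite inE0 in_cons; apply/orP; right.
  apply/flatten_mapP; exists i; first by rewrite mem_enum.
  by apply/mapP; exists h.
have E0E : 0 \in E by rewrite inE0 mem_head.
have : sorted <%R E by rewrite sort_lt_sorted undup_uniq.
case: E E0E sE {inE0} => // e l E0E sE srt.
rewrite -[RHS](altsum_eq0 e l rel) altsum_sum.
apply: eq_bigr => i _; rewrite altsumZ; congr (_ * _).
rewrite (@altsum_interval _ _ _ (e :: l)) //; first last.
- by move=> x; rewrite in_cons => /orP[/eqP->|->]; rewrite ?lexx ?orbT.
- exact: sE.
congr (_%:R); congr nat_of_bool; apply/asboolP/idP.
  by move=> [t]; apply: has_endpoint => //; exact: sE.
by move=> /hasP[t _ st]; exists t.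
Qed.

Definition flow (V : lmodType R) (v : V) (A : set V) : set V :=
  [set x | exists t : R, A (x + t *: v)].

Lemma flow_rel (V : lmodType R) (v : V) (I : finType) (c : I -> K)
    (A : I -> set V) :
  (forall i, polyhedral (A i)) ->
  (forall x, \sum_i c i * \1_(A i) x = 0) ->
  forall x, \sum_i c i * \1_(flow v (A i)) x = 0.
Proof.
move=> /choice[s As] rel x.
pose s1 i := [seq (h.1 v, h.2 - h.1 x) | h : halfspace V <- s i].
have s1E i t : sat1 (s1 i) t = (x + t *: v \in A i).
  rewrite As; apply/idP/idP; rewrite inE /= /sat1 /sat all_map;
    by apply: sub_all => h /=; rewrite linearD linearZ /= lerBrDl mulrC.
transitivity (\sum_i c i * (`[< exists t, sat1 (s1 i) t >])%:R).
  apply: eq_bigr => i _; rewrite indicE; congr (_ * _%:R); congr nat_of_bool.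
  apply/idP/asboolP; rewrite inE => -[t] H; exists t; move: H.
    by rewrite s1E inE.
  by rewrite s1E inE.
apply: line_euler => t; rewrite -[RHS](rel (x + t *: v)).
by apply: eq_bigr => i _; rewrite s1E.
Qed.

Definition flows (V : lmodType R) (vs : seq V) (A : set V) : set V :=
  foldr (@flow V) A vs.

Lemma flows_polyhedral (V : lmodType R) (vs : seq V) (A : set V) :
  polyhedral A -> polyhedral (flows vs A).
Proof. by move=> pA; elim: vs => //= v vs; exact: line_polyhedral. Qed.

Lemma flows_rel (V : lmodType R) (vs : seq V) (I : finType) (c : I -> K)
    (A : I -> set V) :
  (forall i, polyhedral (A i)) ->
  (forall x, \sum_i c i * \1_(A i) x = 0) ->
  forall x, \sum_i c i * \1_(flows vs (A i)) x = 0.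
Proof.
move=> pA rel; elim: vs => //= v vs; apply: flow_rel => i.
exact: flows_polyhedral.
Qed.

Lemma flows_out (U V : lmodType R) (g : {linear V -> U}) (vs : seq V) (A : set V) z :
  {in vs, forall v, g v = 0} -> flows vs A z ->
  exists2 z', A z' & g z' = g z.
Proof.
elim: vs z => [|v vs IHvs] z gvs /=; first by exists z.
case=> t /IHvs[|z' Az' gz']; first by move=> w wvs; rewrite gvs ?inE ?wvs ?orbT.
by exists z' => //; rewrite gz' linearD linearZ /= (gvs v) ?mem_head // scaler0 addr0.
Qed.

Lemma flows_in (V : lmodType R) (J : Type) (r : seq J) (e : J -> V) (t : J -> R)
    (A : set V) z :
  A (z + \sum_(j <- r) t j *: e j) -> flows [seq e j | j <- r] A z.
Proof.
elim: r z => [|j r IHr] z /=; first by rewrite big_nil addr0.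
by rewrite big_cons addrA => H; exists (t j); exact: IHr.
Qed.

Lemma euler_rel d (I : finType) (c : I -> K) (A : I -> set 'rV[R]_d) :
  (forall i, polyhedral (A i)) ->
  (forall x, \sum_i c i * \1_(A i) x = 0) ->
  \sum_i c i * (`[< exists y, A i y >])%:R = 0.
Proof.
move=> pA rel.
pose vs := [seq delta_mx 0 j : 'rV[R]_d | j <- index_enum 'I_d].
rewrite -[RHS](flows_rel vs pA rel 0); apply: eq_bigr => i _.
rewrite indicE; congr (_ * _%:R); congr nat_of_bool.
apply/asboolP/idP; rewrite inE.
  move=> [y Ay]; apply: (@flows_in _ _ _ _ (fun j => y 0 j)).
  by rewrite add0r -row_sum_delta.
have gvs : {in vs, forall v, (\0 : 'rV[R]_d -> 'rV[R]_d) v = 0} by [].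
by move/(flows_out gvs) => [z Az _]; exists z.
Qed.

End Relations.

Section MinkowskiSum.
Variables (R : realFieldType) (d : nat).
Local Notation W := 'rV[R]_d.

Definition minkowski_sum (A B : set W) : set W :=
  [set x + y | x in A & y in B].

Lemma minkowski_sumP (A B : set W) x :
  minkowski_sum A B x <-> exists y, A y /\ B (x - y).
Proof.
split=> [[a Aa [b Bb <-]]|[y [Ay By]]].
  by exists a; rewrite addrAC subrr add0r.
by exists y => //; exists (x - y) => //; rewrite addrC subrK.
Qed.

Definition with0 (x : W) : W * W := (x, 0).
Fact with0_linear : linear with0.
Proof. by move=> k x y; rewrite /with0; congr (_, _); rewrite /= scaler0 addr0. Qed.
HB.instance Definition _ :=
  GRing.isLinear.Build R W (W * W)%type *:%R with0 with0_linear.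

Lemma minkowski_sum_polyhedral (A B : set W) :
  polyhedral A -> polyhedral B -> polyhedral (minkowski_sum A B).
Proof.
move=> pA pB.
pose D : set (W * W) := [set z | A (z.2 + 0)] `&` [set z | B ((z.1 - z.2) + 0)].
have pD : polyhedral D.
  apply: polyhedralI.
    exact: (@polyhedral_preim _ _ _ (snd : {linear (W * W)%type -> W})).
  exact: (@polyhedral_preim _ _ _
           ((fst : {linear (W * W)%type -> W}) \- (snd : {linear (W * W)%type -> W}))).
pose vs := [seq (0, delta_mx 0 j) : W * W | j <- index_enum 'I_d].
have -> : minkowski_sum A B = [set x | flows vs D (with0 x + 0)].
  apply/seteqP; split=> x.
    move/minkowski_sumP => [y [Ay By]] /=; rewrite addr0.
    apply: (@flows_in _ _ _ _ _ (fun j => y 0 j)).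
    have -> : with0 x + \sum_j y 0 j *: (0, delta_mx 0 j) = (x, y) :> W * W.
      rewrite [X in _ = (_, X)]row_sum_delta.
      rewrite [\sum_j _]surjective_pairing !raddf_sum /=.
      rewrite [X in with0 x + (X, _)]big1; last by move=> j _; rewrite scaler0.
      by congr (_, _); rewrite ?addr0 ?add0r.
    by rewrite /D /= !addr0.
  rewrite /= addr0 => H; apply/minkowski_sumP.
  have gvs : {in vs, forall v, (fst : {linear (W * W)%type -> W}) v = 0}.
    by move=> _ /mapP[j _ ->].
  have [[x' y] [] /=] := flows_out gvs H.
  by rewrite !addr0 => Ay By ?; exists y; subst x'.
apply: (@polyhedral_preim _ _ _ with0); exact: flows_polyhedral.
Qed.

Lemma minkowski_sum_rel (K : nzRingType) (I : finType) (c : I -> K)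
    (A : I -> set W) (B : set W) :
  (forall i, polyhedral (A i)) -> polyhedral B ->
  (forall x, \sum_i c i * \1_(A i) x = 0) ->
  forall x, \sum_i c i * \1_(minkowski_sum (A i) B) x = 0.
Proof.
move=> pA pB rel x.
pose C i := A i `&` [set y | B (- y + x)].
have pC i : polyhedral (C i).
  apply: polyhedralI => //.
  exact: (@polyhedral_preim _ _ _ (-%R : {linear W -> W})).
rewrite -[RHS](euler_rel pC (c := c)) => [|y].
  apply: eq_bigr => i _; rewrite indicE; congr (_ * _%:R); congr nat_of_bool.
  apply/idP/asboolP; rewrite inE.
    by move/minkowski_sumP => [y [Ay By]]; exists y; split=> //=; rewrite addrC.
  move=> [y [Ay By]]; apply/minkowski_sumP; exists y.
  by split=> //; rewrite addrC.
transitivity ((\sum_i c i * \1_(A i) y) * \1_[set y | B (- y + x)] y).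
  rewrite mulr_suml; apply: eq_bigr => i _.
  by rewrite -mulrA !indicE /C in_setI -natrM mulnb.
by rewrite rel mul0r.
Qed.

End MinkowskiSum.

Section PolyhedralFunctions.
Variables (R : realType) (d : nat).
Local Notation W := 'rV[R]_d.
Local Notation C := R[i].

(* The empty set is a polyhedron too; its indicator is 0, so that including
   it changes neither the span nor the generated rings. *)
Record polyhedron := Polyhedron {
  polyhedron_set :> set W;
  polyhedronP : polyhedral polyhedron_set
}.

Definition in_polyhedral_span : {pred (W -> C)} := fun f =>
  `[< exists s : seq (C * polyhedron), f = \sum_(p <- s) p.1 *: \1_(p.2) >].

Fact in_polyhedral_span_closed : subsemimod_closed in_polyhedral_span.
Proof.
apply: GRing.submod_closed_semi; split.
  by apply/asboolP; exists [::]; rewrite big_nil.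
move=> k f g /asboolP[s ->] /asboolP[t ->]; apply/asboolP.
exists ([seq (k * p.1, p.2) | p <- s] ++ t).
rewrite big_cat big_map scaler_sumr; congr (_ + _).
by apply: eq_bigr => p _; rewrite scalerA.
Qed.
HB.instance Definition _ :=
  GRing.isSubmodClosed.Build C (W -> C) in_polyhedral_span
    in_polyhedral_span_closed.

Record polyhedral_fun := PolyhedralFun {
  polyfun :> W -> C;
  polyfunP : polyfun \in in_polyhedral_span
}.
HB.instance Definition _ := [isSub for polyfun].
HB.instance Definition _ := [Choice of polyhedral_fun by <:].
HB.instance Definition _ := [SubChoice_isSubZmodule of polyhedral_fun by <:].
HB.instance Definition _ := [SubZmodule_isSubLmodule of polyhedral_fun by <:].

Fact indic_in_span (P : polyhedron) : (\1_P : W -> C) \in in_polyhedral_span.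
Proof. by apply/asboolP; exists [:: (1, P)]; rewrite big_seq1 scale1r. Qed.

Definition pind (P : polyhedron) : polyhedral_fun :=
  PolyhedralFun (indic_in_span P).

Definition msum (P Q : polyhedron) : polyhedron :=
  Polyhedron (minkowski_sum_polyhedral (polyhedronP P) (polyhedronP Q)).

Implicit Types s t u : seq (C * polyhedron).

Definition lincomb_pind s : polyhedral_fun := \sum_(p <- s) p.1 *: pind p.2.

Definition tensor s t : seq (C * polyhedron) :=
  [seq (p.1 * q.1, msum p.2 q.2) | p <- s, q <- t].

Lemma lincomb_pindE s :
  polyfun (lincomb_pind s) = \sum_(p <- s) p.1 *: \1_(p.2).
Proof.
rewrite /lincomb_pind; elim: s => [|p s IHs]; first by rewrite !big_nil.
by rewrite !big_cons -IHs.
Qed.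

Lemma lincomb_pind_surj (f : polyhedral_fun) : exists s, f = lincomb_pind s.
Proof.
have /asboolP[s fE] := polyfunP f; exists s.
by apply: val_inj; rewrite /= lincomb_pindE.
Qed.

Definition decomposition (f : polyhedral_fun) : seq (C * polyhedron) :=
  sval (cid (lincomb_pind_surj f)).

Lemma decompositionK f : lincomb_pind (decomposition f) = f.
Proof. by rewrite /decomposition; case: cid. Qed.

(* The bilinear product with [A] * [B] = [A + B] (lemma pindM): it is defined
   through chosen decompositions, and does not depend on them (lemma mulfE). *)
Definition mulf (f g : polyhedral_fun) : polyhedral_fun :=
  lincomb_pind (tensor (decomposition f) (decomposition g)).

Lemma lincomb_pind_cat s t :
  lincomb_pind (s ++ t) = lincomb_pind s + lincomb_pind t.
Proof. by rewrite /lincomb_pind big_cat. Qed.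

Lemma lincomb_tensor s t : lincomb_pind (tensor s t) =
  \sum_(p <- s) \sum_(q <- t) (p.1 * q.1) *: pind (msum p.2 q.2).
Proof. by rewrite /lincomb_pind /tensor big_allpairs_dep. Qed.

Lemma pind_eq (P Q : polyhedron) : P = Q :> set W -> pind P = pind Q.
Proof. by move=> PQ; apply: val_inj; rewrite /= PQ. Qed.

Lemma msumC (P Q : polyhedron) : msum P Q = msum Q P :> set W.
Proof.
by apply/seteqP; split=> _ [x Px [y Qy <-]];
  exists y => //; exists x => //; rewrite addrC.
Qed.

Lemma msumA (P Q S : polyhedron) :
  msum P (msum Q S) = msum (msum P Q) S :> set W.
Proof.
apply/seteqP; split.
  move=> _ [x Px [_ [y Qy [z Sz <-]] <-]].
  by exists (x + y); [exists x => //; exists y | exists z => //; rewrite addrA].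
move=> _ [_ [x Px [y Qy <-]] [z Sz <-]].
by exists x => //; exists (y + z); [exists y => //; exists z | rewrite addrA].
Qed.

Lemma tensorC s t : lincomb_pind (tensor s t) = lincomb_pind (tensor t s).
Proof.
rewrite !lincomb_tensor exchange_big; apply: eq_bigr => q _.
by apply: eq_bigr => p _; rewrite mulrC (pind_eq (msumC _ _)).
Qed.

Lemma tensor_eq0 s t :
  lincomb_pind s = 0 -> lincomb_pind (tensor s t) = 0.
Proof.
move=> s0; rewrite lincomb_tensor exchange_big /= big1 // => q _.
transitivity (q.1 *: lincomb_pind [seq (p.1, msum p.2 q.2) | p <- s]).
  rewrite /lincomb_pind big_map scaler_sumr; apply: eq_bigr => p _.
  by rewrite scalerA mulrC.
suff -> : lincomb_pind [seq (p.1, msum p.2 q.2) | p <- s] = 0 by rewrite scaler0.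
apply: val_inj; rewrite /= lincomb_pindE big_map fct_sumE; apply/funext => x.
pose ss := in_tuple s.
have := @minkowski_sum_rel R d C 'I_(size s) (fun i => (tnth ss i).1)
  (fun i => (tnth ss i).2) q.2 (fun i => polyhedronP _) (polyhedronP _).
rewrite (big_tnth _ _ s) => -> // y.
have /(congr1 (@^~ y)) : polyfun (lincomb_pind s) = \0 by rewrite s0.
by rewrite lincomb_pindE fct_sumE (big_tnth _ _ s).
Qed.

Lemma tensor_wdl s s' t : lincomb_pind s = lincomb_pind s' ->
  lincomb_pind (tensor s t) = lincomb_pind (tensor s' t).
Proof.
move=> ss'; pose opp := map (fun p : C * polyhedron => (- p.1, p.2)).
have /tensor_eq0 -/(_ t) : lincomb_pind (s ++ opp s') = 0.
  rewrite lincomb_pind_cat ss' /lincomb_pind big_map -big_split /= big1 // => p _.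
  by rewrite scaleNr subrr.
rewrite !lincomb_tensor big_cat big_map /= => /eqP.
rewrite addr_eq0 => /eqP ->; rewrite -sumrN; apply: eq_bigr => p _.
by rewrite -sumrN; apply: eq_bigr => q _; rewrite mulNr scaleNr opprK.
Qed.

Lemma mulfE s t :
  mulf (lincomb_pind s) (lincomb_pind t) = lincomb_pind (tensor s t).
Proof.
rewrite /mulf (tensor_wdl _ (decompositionK _)) tensorC.
by rewrite (tensor_wdl _ (decompositionK _)) tensorC.
Qed.

Fact mulfC : commutative mulf.
Proof.
by move=> f g; rewrite -(decompositionK f) -(decompositionK g) !mulfE tensorC.
Qed.

Fact mulfA : associative mulf.
Proof.
move=> f g h; rewrite -(decompositionK f) -(decompositionK g) -(decompositionK h).
rewrite !mulfE /lincomb_pind /tensor !big_allpairs_dep; apply: eq_bigr => p _.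
rewrite !big_allpairs_dep; apply: eq_bigr => q _; apply: eq_bigr => r _ /=.
by rewrite mulrA (pind_eq (msumA _ _ _)).
Qed.

Fact mulfDl : left_distributive mulf +%R.
Proof.
move=> f g h; rewrite -(decompositionK f) -(decompositionK g) -(decompositionK h).
by rewrite -lincomb_pind_cat !mulfE !lincomb_tensor big_cat.
Qed.

Definition coord (j : 'I_d) (x : W) : R := x 0 j.
Fact coord_linear j : scalar (coord j).
Proof. by move=> k x y; rewrite /coord !mxE. Qed.
HB.instance Definition _ j :=
  GRing.isLinear.Build R W R *%R (coord j) (coord_linear j).

Lemma polyhedral_box (a b : 'I_d -> R) :
  polyhedral [set x : W | forall j, a j <= x 0 j <= b j].
Proof.
pose le j : halfspace W := ((coord j : {scalar W}), b j).
pose ge j : halfspace W := (lincombL (coord j) (coord j) (-1) 0, - a j).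
exists ([seq le j | j <- index_enum 'I_d] ++ [seq ge j | j <- index_enum 'I_d]).
apply/seteqP; split=> x; rewrite /= /sat all_cat !all_map.
  move=> xab; apply/andP; split; apply/allP => j _ /=;
    have /andP[aj bj] := xab j; first exact: bj.
  by rewrite /lincomb /= /coord mul0r addr0 mulN1r lerN2.
case/andP=> /allP Hle /allP Hge j.
have ej : j \in index_enum 'I_d by exact: mem_index_enum.
apply/andP; split; last exact: (Hle _ ej).
have := Hge _ ej; rewrite /= /lincomb /= /coord mul0r addr0 mulN1r.
by rewrite lerN2.
Qed.

Lemma polyhedral0 : polyhedral [set 0 : W].
Proof.
have -> : [set 0 : W] = [set x : W | forall j, 0 <= x 0 j <= 0].
  apply/seteqP; split=> [_ -> j|x x0]; first by rewrite mxE lexx.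
  by apply/rowP => j; rewrite mxE; apply/esym/le_anti.
exact: (polyhedral_box (fun=> 0) (fun=> 0)).
Qed.

Definition onef : polyhedral_fun := pind (Polyhedron polyhedral0).

Fact mul1f : left_id onef mulf.
Proof.
move=> f; rewrite -(decompositionK f).
have -> : onef = lincomb_pind [:: (1, Polyhedron polyhedral0)].
  by rewrite /lincomb_pind big_seq1 scale1r.
rewrite mulfE lincomb_tensor big_seq1 /lincomb_pind; apply: eq_bigr => p _.
rewrite mul1r; congr (_ *: _); apply: pind_eq; apply/seteqP; split=> x.
  by move=> [_ -> [y ? <-]]; rewrite add0r.
by move=> px; exists 0 => //; exists x; rewrite ?add0r.
Qed.

Fact onef_neq0 : onef != 0.
Proof.
apply/eqP => /(congr1 (fun f : polyhedral_fun => f 0)) /=.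
by rewrite indicE mem_set //; apply/eqP; rewrite oner_eq0.
Qed.

HB.instance Definition _ := GRing.Zmodule_isComNzRing.Build polyhedral_fun
  mulfA mulfC mul1f mulfDl onef_neq0.

Fact scalefAl (k : C) (f g : polyhedral_fun) : k *: (f * g) = (k *: f) * g.
Proof.
rewrite -[f]decompositionK -[g]decompositionK.
set s := decomposition f; set t := decomposition g.
have -> : k *: lincomb_pind s = lincomb_pind [seq (k * p.1, p.2) | p <- s].
  rewrite /lincomb_pind scaler_sumr big_map; apply: eq_bigr => p _.
  by rewrite scalerA.
rewrite /GRing.mul /= !mulfE !lincomb_tensor big_map scaler_sumr.
apply: eq_bigr => p _; rewrite scaler_sumr; apply: eq_bigr => q _.
by rewrite scalerA mulrA.
Qed.

HB.instance Definition _ :=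
  GRing.Lmodule_isLalgebra.Build C polyhedral_fun scalefAl.
HB.instance Definition _ :=
  GRing.Lalgebra_isComAlgebra.Build C polyhedral_fun.

Lemma pindM (P Q : polyhedron) : pind P * pind Q = pind (msum P Q).
Proof.
have pindE S : pind S = lincomb_pind [:: (1, S)].
  by rewrite /lincomb_pind big_seq1 scale1r.
by rewrite !pindE /GRing.mul /= mulfE lincomb_tensor !big_seq1 mulr1 scale1r -pindE.
Qed.

End PolyhedralFunctions.

Section GeneratedSubalgebra.
Variables (K : nzRingType) (A : algType K) (G : set A).

Definition generated_subalg : {pred A} := fun f =>
  `[< forall S : {pred A}, GRing.subalg_closed S ->
        (forall g, G g -> g \in S) -> f \in S >].

Fact generated_subalg_closed : GRing.subalg_closed generated_subalg.
Proof.
split.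
- by apply/asboolP => S [].
- move=> k f g /asboolP Hf /asboolP Hg; apply/asboolP => S HS GS.
  by have [_ Slin _] := HS; apply: Slin; [exact: Hf | exact: Hg].
- move=> f g /asboolP Hf /asboolP Hg; apply/asboolP => S HS GS.
  by have [_ _ SM] := HS; apply: SM; [exact: Hf | exact: Hg].
Qed.
HB.instance Definition _ := GRing.isSubalgClosed.Build K A generated_subalg
  (GRing.subalg_closed_semi generated_subalg_closed).
End GeneratedSubalgebra.

Section MinkowskiRing.
Variables (R : realType) (d : nat) (D : set (polyhedron R d)).

Record minkowski_ring := MinkowskiElt {
  minkowski_val :> polyhedral_fun R d;
  minkowski_valP : minkowski_val \in generated_subalg (@pind R d @` D)
}.
HB.instance Definition _ := [isSub for minkowski_val].
HB.instance Definition _ := [Choice of minkowski_ring by <:].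
HB.instance Definition _ := [SubChoice_isSubAlgebra of minkowski_ring by <:].
HB.instance Definition _ := [SubNzRing_isSubComNzRing of minkowski_ring by <:].
End MinkowskiRing.

Section Boxes.
Variables (R : realType) (d : nat).

Definition box (a b : 'I_d -> int) : set 'rV[R]_d :=
  [set x | forall i, (a i)%:~R <= x 0 i <= (b i)%:~R].

Definition boxes : set (polyhedron R d) :=
  [set P | exists a b : 'I_d -> int,
     (forall i, a i <= b i) /\ polyhedron_set P = box a b].

Definition unit_cube : set 'rV[R]_d := [set x | forall i, 0 <= x 0 i <= 1].

Definition axis_proj (i : 'I_d) (x : 'rV[R]_d) : 'rV[R]_d :=
  x 0 i *: delta_mx 0 i.
End Boxes.
Arguments boxes : clear implicits.
Arguments unit_cube : clear implicits.

Section GroupAlgebra.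
Variables (K : comNzRingType) (G : zmodType).

Definition group_algebra : Type := {malg K[G]}.
HB.instance Definition _ := GRing.Lmodule.copy group_algebra {malg K[G]}.

Implicit Types (g : group_algebra) (k : G).

Definition galg1 : group_algebra := mkmalgU 0 1.

Definition galg_mul g1 g2 : group_algebra :=
  \sum_(k1 <- msupp g1) \sum_(k2 <- msupp g2)
    mkmalgU (k1 + k2) (mcoeff k1 g1 * mcoeff k2 g2).

Lemma galg_mulw (d1 d2 : {fset G}) g1 g2 :
  (msupp g1 `<=` d1)%fset -> (msupp g2 `<=` d2)%fset ->
  galg_mul g1 g2 = \sum_(k1 <- d1) \sum_(k2 <- d2)
    mkmalgU (k1 + k2) (mcoeff k1 g1 * mcoeff k2 g2).
Proof.
move=> le_d1 le_d2; rewrite /galg_mul (big_fset_incl _ le_d1) /=.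
  apply/eq_bigr=> k1 _; apply/big_fset_incl => // k _ /mcoeff_outdom ->.
  by rewrite mulr0 monalgU0.
move=> k _ /mcoeff_outdom g1k.
by rewrite big1 => // k' _; rewrite g1k mul0r monalgU0.
Qed.

Lemma galg_mulC : commutative galg_mul.
Proof.
move=> g1 g2; rewrite /galg_mul exchange_big; apply: eq_bigr => k2 _.
by apply: eq_bigr => k1 _; rewrite mulrC addrC.
Qed.

Lemma galg_mulDl : left_distributive galg_mul +%R.
Proof.
move=> g1 g2 g.
rewrite [in RHS](galg_mulw (fsubsetUl _ (msupp g2)) (fsubset_refl _)).
rewrite [in RHS](galg_mulw (fsubsetUr (msupp g1) _) (fsubset_refl _)).
rewrite (galg_mulw (msuppD_le _ _) (fsubset_refl _)).
rewrite -big_split /=; apply/eq_bigr=> k1 _.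
rewrite -big_split /=; apply/eq_bigr=> k2 _.
by rewrite mcoeffD mulrDl monalgUD.
Qed.

Lemma galg_mulDr : right_distributive galg_mul +%R.
Proof.
by move=> g g1 g2; rewrite galg_mulC galg_mulDl ![galg_mul _ g]galg_mulC.
Qed.

Lemma galg_mul0g : left_zero 0 galg_mul.
Proof. by move=> g; rewrite /galg_mul msupp0 big_seq_fset0. Qed.

Lemma galg_mulg0 : right_zero 0 galg_mul.
Proof. by move=> g; rewrite galg_mulC galg_mul0g. Qed.

Lemma galg_mulUU k1 k2 (c1 c2 : K) :
  galg_mul (mkmalgU k1 c1) (mkmalgU k2 c2) = mkmalgU (k1 + k2) (c1 * c2).
Proof.
by rewrite (galg_mulw msuppU_le msuppU_le) !big_seq_fset1 !mcoeffUU.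
Qed.

Lemma galg_ind (P : group_algebra -> Prop) :
  P 0 -> (forall g1 g2, P g1 -> P g2 -> P (g1 + g2)) ->
  (forall k c, P (mkmalgU k c)) -> forall g, P g.
Proof.
move=> P0 PD PU g; rewrite (monalgE g).
by elim/big_rec: _ => // k g' _; exact: PD.
Qed.

Lemma galg_mulA : associative galg_mul.
Proof.
move=> g1; elim/galg_ind: g1 => [g2 g3|g1 g1' IH IH' g2 g3|k1 c1 g2].
- by rewrite !galg_mul0g.
- by rewrite !galg_mulDl IH IH'.
elim/galg_ind: g2 => [g3|g2 g2' IH IH' g3|k2 c2 g3].
- by rewrite !(galg_mul0g, galg_mulg0).
- by rewrite !(galg_mulDl, galg_mulDr) IH IH'.
elim/galg_ind: g3 => [|g3 g3' IH IH'|k3 c3].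
- by rewrite !galg_mulg0.
- by rewrite !galg_mulDr IH IH'.
by rewrite !galg_mulUU addrA mulrA.
Qed.

Lemma galg_mul1g : left_id galg1 galg_mul.
Proof.
move=> g; elim/galg_ind: g => [|g1 g2 IH1 IH2|k c]; first exact: galg_mulg0.
  by rewrite galg_mulDr IH1 IH2.
by rewrite galg_mulUU add0r mul1r.
Qed.

Lemma galg1_neq0 : galg1 != 0.
Proof. by rewrite monalgU_eq0 oner_eq0. Qed.

HB.instance Definition _ := GRing.Zmodule_isComNzRing.Build group_algebra
  galg_mulA galg_mulC galg_mul1g galg_mulDl galg1_neq0.

Lemma galg_scaleAl (c : K) (g1 g2 : group_algebra) :
  c *: (g1 * g2) = (c *: g1) * g2.
Proof.
have scaleU k (c' : K) : c *: mkmalgU k c' = mkmalgU k (c * c') :> {malg K[G]}.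
  by apply/malgP => k'; rewrite mcoeffZ !mcoeffU mulrnAr.
elim/galg_ind: g1 => [|g1 g1' IH IH'|k1 c1].
- by rewrite mul0r !scaler0 mul0r.
- by rewrite mulrDl !scalerDr mulrDl IH IH'.
elim/galg_ind: g2 => [|g2 g2' IH IH'|k2 c2].
- by rewrite !mulr0 scaler0.
- by rewrite !mulrDr scalerDr IH IH'.
by rewrite scaleU /GRing.mul /= !galg_mulUU -mulrA scaleU.
Qed.

HB.instance Definition _ := GRing.Lmodule_isLalgebra.Build K group_algebra
  galg_scaleAl.
HB.instance Definition _ := GRing.Lalgebra_isComAlgebra.Build K group_algebra.

Definition augmentation : group_algebra -> K := mmap idfun (fun=> 1).

Lemma augmentationU k c : augmentation (mkmalgU k c) = c.
Proof. by rewrite /augmentation mmapU mulr1. Qed.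

Lemma augmentation0 : augmentation 0 = 0.
Proof. exact: mmap0. Qed.

Lemma augmentationD g1 g2 :
  augmentation (g1 + g2) = augmentation g1 + augmentation g2.
Proof. exact: mmapD. Qed.

Lemma augmentationN g : augmentation (- g) = - augmentation g.
Proof. exact: mmapN. Qed.

Lemma augmentation1 : augmentation 1 = 1.
Proof. exact: augmentationU. Qed.

Lemma augmentationM g1 g2 :
  augmentation (g1 * g2) = augmentation g1 * augmentation g2.
Proof.
elim/galg_ind: g1 => [|g1 g1' IH IH'|k1 c1].
- by rewrite mul0r augmentation0 mul0r.
- by rewrite mulrDl !augmentationD mulrDl IH IH'.
elim/galg_ind: g2 => [|g2 g2' IH IH'|k2 c2].
- by rewrite mulr0 augmentation0 mulr0.
- by rewrite mulrDr !augmentationD mulrDr IH IH'.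
by rewrite /GRing.mul /= galg_mulUU !augmentationU.
Qed.

End GroupAlgebra.

(* Laurent polynomials in variables indexed by I: the group algebra of the
   free abelian group of exponents. *)
Notation laurent K I := (group_algebra K {ffun I -> int}).

(* Locked so that unification does not try to compare finite supports. *)
HB.lock Definition laurent_var (K : comNzRingType) (I : finType) (j : I) : laurent K I :=
  mkmalgU [ffun k => Posz (k == j)] 1.

Definition generated_ideal (A : comNzRingType) (I : finType) (g : I -> A) :
    {pred A} :=
  fun p => `[< exists h : I -> A, p = \sum_i h i * g i >].

Fact generated_ideal_linear (A : comNzRingType) (I : finType) (g : I -> A) a :
  {in generated_ideal g &, forall u v, a * u + v \in generated_ideal g}.
Proof.
move=> u v /asboolP[h ->] /asboolP[k ->]; apply/asboolP.
exists (fun i => a * h i + k i); rewrite mulr_sumr -big_split /=.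
by apply: eq_bigr => i _; rewrite mulrDl mulrA.
Qed.

Section QuotientAlgebra.
Variables (K : comNzRingType) (A : comAlgType K) (I : idealr A).
Local Open Scope quotient_scope.

Definition quot_scale (c : K) (x : {ideal_quot I}) : {ideal_quot I} :=
  \pi_{ideal_quot I} (c *: repr x).

Lemma pi_scale (c : K) (a : A) :
  \pi_{ideal_quot I} (c *: a) = quot_scale c (\pi_{ideal_quot I} a).
Proof.
apply/eqP; rewrite -Quotient.idealrBE -scalerBr -mulr_algl.
by rewrite idealMr // Quotient.idealrBE reprK.
Qed.

Fact quot_scaleA a b x : quot_scale a (quot_scale b x) = quot_scale (a * b) x.
Proof. by rewrite -[x]reprK -(pi_scale b) -!pi_scale scalerA. Qed.
Fact quot_scale1 : left_id 1 quot_scale.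
Proof. by move=> x; rewrite -[x]reprK -pi_scale scale1r. Qed.
Fact quot_scaleDr : right_distributive quot_scale +%R.
Proof.
by move=> c x y; rewrite -[x]reprK -[y]reprK -raddfD -!pi_scale scalerDr raddfD.
Qed.
Fact quot_scaleDl x : {morph quot_scale^~ x : a b / a + b}.
Proof. by move=> a b; rewrite -[x]reprK -!pi_scale scalerDl raddfD. Qed.

HB.instance Definition _ := GRing.Zmodule_isLmodule.Build K {ideal_quot I}
  quot_scaleA quot_scale1 quot_scaleDr quot_scaleDl.

Fact quot_scaleAl (c : K) (x y : {ideal_quot I}) : c *: (x * y) = (c *: x) * y.
Proof.
rewrite -[x]reprK -[y]reprK -rmorphM /GRing.scale /= -!pi_scale -rmorphM.
by rewrite scalerAl.
Qed.

HB.instance Definition _ := GRing.Lmodule_isLalgebra.Build K {ideal_quot I}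
  quot_scaleAl.
HB.instance Definition _ := GRing.Lalgebra_isComAlgebra.Build K {ideal_quot I}.
End QuotientAlgebra.

Notation laurent_xy R d := (laurent R[i] ('I_d + 'I_d)%type).

Section BoxIdeal.
Variables (R : realType) (d : nat).

Definition var_x (i : 'I_d) : laurent_xy R d := laurent_var _ (inl i).
Definition var_y (i : 'I_d) : laurent_xy R d := laurent_var _ (inr i).

Definition box_relation (i : 'I_d) : laurent_xy R d :=
  (var_y i - 1) * (var_y i - var_x i).

Definition box_ideal : {pred laurent_xy R d} := generated_ideal box_relation.

Fact box_ideal_closed : idealr_closed box_ideal.
Proof.
split.
- by apply/asboolP; exists (fun=> 0); rewrite big1 // => i _; rewrite mul0r.
- apply/asboolP => -[h E].
  suff : augmentation (1 : laurent_xy R d) = 0.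
    by move/eqP; rewrite augmentation1 oner_eq0.
  rewrite {}E; elim/big_rec: _ => [|i p _ IHp]; first exact: augmentation0.
  have y1 : augmentation (var_y i - 1) = 0.
    by rewrite augmentationD augmentationN augmentation1 /var_y laurent_var.unlock augmentationU subrr.
  by rewrite augmentationD IHp addr0 !augmentationM y1 mul0r mulr0.
- exact: generated_ideal_linear.
Qed.
HB.instance Definition _ := isIdealr.Build (laurent_xy R d) box_ideal box_ideal_closed.

Definition box_values
    (phi : laurent_xy R d -> minkowski_ring (boxes R d)) : Prop :=
  (forall i, phi (var_x i) = \1_[set delta_mx 0 i] :> ('rV[R]_d -> R[i])) /\
  (forall i, phi (var_y i) = \1_(axis_proj i @` unit_cube R d)
               :> ('rV[R]_d -> R[i])).
End BoxIdeal.
Arguments box_ideal : clear implicits.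

(* Main.v *)
(* The image of phi contains every box, since [prod [a_i, a_i + n_i]] is the
   product of the [e_i]^{a_i} [[0, e_i]]^{n_i}.  Modulo the ideal, substitute
   z_i = y_i - 1 - x_i: the relation becomes z_i^2 = -(1 + x_i) z_i - x_i, and
   y_i^{-1} = - x_i^{-1} z_i, so every Laurent polynomial is congruent to a
   combination of the monomials x^m \prod_{i in S} z_i.  Now phi (z_i) is the
   indicator of the open segment ]0, e_i[, so these monomials are sent to the
   indicators of the cells of the cubical subdivision of R^d; the cells are
   pairwise disjoint, hence the kernel is exactly the ideal. *)

Require Import Defs.
From HB Require Import structures.
From mathcomp Require Import all_boot all_order all_algebra.
From mathcomp Require Import finmap.
From mathcomp Require Import boolp classical_sets functions reals numfun.
From mathcomp.multinomials Require Import monalg.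
From mathcomp Require Import complex.
From mathcomp Require Import ring lra zify.

Set Implicit Arguments.
Unset Strict Implicit.
Unset Printing Implicit Defensive.

Import Order.TTheory GRing.Theory Num.Theory.
Local Open Scope classical_set_scope.
Local Open Scope ring_scope.
Local Open Scope quotient_scope.

(* Locked for the same reason as [laurent_var]. *)
HB.lock Definition monomial (K : comNzRingType) (I : finType)
  (k : {ffun I -> int}) : laurent K I := mkmalgU k 1.

(** * Laurent monomials and induction on Laurent polynomials *)

Section LaurentMonomials.
Variables (K : comNzRingType) (I : finType).
Implicit Types (k l : {ffun I -> int}) (p q : laurent K I).
Local Notation monomial := (@monomial K I).

Lemma monomialD k l : monomial (k + l) = monomial k * monomial l.
Proof. by rewrite monomial.unlock [RHS]galg_mulUU mulr1. Qed.

Lemma monomial0 : monomial 0 = 1.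
Proof. by rewrite monomial.unlock. Qed.

Definition exponent (j : I) : {ffun I -> int} := [ffun i => Posz (i == j)].

Lemma laurent_varE j : laurent_var K j = monomial (exponent j).
Proof. by rewrite laurent_var.unlock monomial.unlock. Qed.

Lemma exponent_sum k : k = \sum_j exponent j *~ k j.
Proof.
apply/ffunP => i; rewrite sum_ffunE (bigD1 i) //= big1 => [|j ji].
  by rewrite addr0 ffunMzE ffunE eqxx mulrzz mul1r.
by rewrite ffunMzE ffunE eq_sym (negbTE ji) mul0rz.
Qed.

Lemma galgUE k (c : K) : mkmalgU k c = c *: monomial k.
Proof. by apply/malgP => k'; rewrite monomial.unlock mcoeffZ !mcoeffU mulrnAr mulr1. Qed.

(** Exponents are integer combinations of unit exponents, so each monomial is reached from 1 by
    multiplying by variables and their inverses; linearity does the rest. *)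
Lemma laurent_ind (P : laurent K I -> Prop) :
  P 1 -> (forall p q, P p -> P q -> P (p + q)) ->
  (forall c p, P p -> P (c *: p)) ->
  (forall j p, P p -> P (p * monomial (exponent j))) ->
  (forall j p, P p -> P (p * monomial (- exponent j))) ->
  forall p, P p.
Proof.
move=> P1 PD PZ Pv PvV.
have P0 : P 0 by rewrite -(scale0r 1); exact: PZ.
pose H k := forall p, P p -> P (p * monomial k).
have H0 : H 0 by move=> p; rewrite monomial0 mulr1.
have HD k l : H k -> H l -> H (k + l).
  by move=> Hk Hl p /Hk /Hl; rewrite monomialD mulrA.
have Hn j n : H (exponent j *+ n) /\ H (- (exponent j *+ n)).
  elim: n => [|n [IH1 IH2]]; first by rewrite mulr0n oppr0.
  by rewrite mulrS opprD; split; [exact (HD _ _ (Pv j) IH1) | exact (HD _ _ (PvV j) IH2)].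
have HU k : H k.
  rewrite (exponent_sum k); elim/big_rec: _ => [|j l _ Hl]; first exact H0.
  refine (HD _ _ _ Hl); case: (k j) => n; first exact (Hn j n).1.
  exact (Hn j n.+1).2.
move=> p; elim/galg_ind: p => // k c; rewrite galgUE; apply: PZ.
by rewrite -[monomial k]mul1r; exact: HU.
Qed.

End LaurentMonomials.

(** * Integer powers of a unit with a given inverse *)

Section IntegerPowers.
Variables (B : comNzRingType) (u v : B).
Hypothesis uv1 : u * v = 1.

(** The inverse [v] is a parameter because [B] carries no inversion operation. [Negz m] stands for
    -(m + 1), whence the power [m.+1]. *)
Definition zpow (n : int) : B :=
  match n with Posz m => u ^+ m | Negz m => v ^+ m.+1 end.

(** Every integer is a difference of naturals, and in this form additivity of [zpow] requires no
    discussion of signs. *)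
Lemma zpow_sub (m n : nat) : zpow (Posz m - Posz n) = u ^+ m * v ^+ n.
Proof.
have uvX r : u ^+ r * v ^+ r = 1 by rewrite -exprMn uv1 expr1n.
have [nm|/ltnW mn] := leqP n m.
  by rewrite subzn // -{2}(subnK nm) exprD -mulrA uvX mulr1.
have -> : Posz m - Posz n = - Posz (n - m) by rewrite -subzn // opprB.
rewrite -{2}(subnKC mn) exprD mulrA uvX mul1r.
by case: (n - m)%N.
Qed.

Lemma zpowD a b : zpow (a + b) = zpow a * zpow b.
Proof.
have intE (c : int) : exists m n : nat, c = Posz m - Posz n.
  by case: c => m; [exists m, 0%N; rewrite subr0 | exists 0%N, m.+1; rewrite sub0r NegzE].
have [m [n ->]] := intE a; have [r [s ->]] := intE b.
by rewrite addrACA -opprD -!PoszD !zpow_sub !exprD mulrACA.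
Qed.

End IntegerPowers.

(** * Evaluation of Laurent polynomials at units of an algebra *)

Lemma mmap_in_algU (K : comNzRingType) (T : choiceType) (B : algType K)
    (h : T -> B) (c : K) (t : T) : mmap (in_alg B) h (mkmalgU t c) = c *: h t.
Proof. by rewrite mmapU mulr_algl. Qed.

Lemma mmap_in_algZ (K : comNzRingType) (T : choiceType) (B : algType K)
    (h : T -> B) : scalable (mmap (in_alg B) h : {malg K[T]} -> B).
Proof.
move=> c q; rewrite (mmapEw (msuppZ_le _ _)) mmapE scaler_sumr.
by apply: eq_bigr => t _; rewrite mcoeffZ !mulr_algl scalerA.
Qed.

Section LaurentEvaluation.
Variables (K : comNzRingType) (I : finType) (B : comAlgType K) (u v : I -> B).
Hypothesis uv1 : forall j, u j * v j = 1.

Definition monomial_eval (k : {ffun I -> int}) : B := \prod_j zpow (u j) (v j) (k j).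

Lemma monomial_evalD k l :
  monomial_eval (k + l) = monomial_eval k * monomial_eval l.
Proof.
by rewrite -big_split; apply: eq_bigr => j _ /=; rewrite ffunE zpowD.
Qed.

Definition laurent_eval (p : laurent K I) : B := mmap (in_alg B) monomial_eval p.

Lemma laurent_evalU k c : laurent_eval (mkmalgU k c) = c *: monomial_eval k.
Proof. exact: mmap_in_algU. Qed.

Fact laurent_eval_additive : additive laurent_eval.
Proof. exact: mmap_is_additive. Qed.

Fact laurent_eval_scalable : scalable laurent_eval.
Proof. exact: mmap_in_algZ. Qed.

Fact laurent_eval_monoid_morphism : monoid_morphism laurent_eval.
Proof.
have D := mmapD (f := in_alg B) (h := monomial_eval).
split.
  rewrite [LHS](laurent_evalU 0 1) scale1r /monomial_eval big1 // => j _.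
  by rewrite ffunE.
move=> p q; elim/galg_ind: p => [|p p' IH IH'|k1 c1].
- by rewrite mul0r /laurent_eval mmap0 mul0r.
- by rewrite mulrDl /laurent_eval !D mulrDl; congr (_ + _).
elim/galg_ind: q => [|q q' IH IH'|k2 c2].
- by rewrite mulr0 /laurent_eval mmap0 mulr0.
- by rewrite mulrDr /laurent_eval !D mulrDr; congr (_ + _).
rewrite [X in laurent_eval X]galg_mulUU !laurent_evalU monomial_evalD.
by rewrite -scalerAl -scalerAr scalerA.
Qed.

HB.instance Definition _ := GRing.isAdditive.Build (laurent K I) B laurent_eval
  laurent_eval_additive.
HB.instance Definition _ := GRing.isScalable.Build K (laurent K I) B *:%R laurent_eval
  laurent_eval_scalable.
HB.instance Definition _ := GRing.isMonoidMorphism.Build (laurent K I) B laurent_eval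
  laurent_eval_monoid_morphism.

Definition laurent_morph : {lrmorphism laurent K I -> B} := laurent_eval.

Lemma laurent_morph_monomial k : laurent_morph (monomial K k) = monomial_eval k.
Proof. by rewrite monomial.unlock [LHS]laurent_evalU scale1r. Qed.

Lemma laurent_morph_var j : laurent_morph (laurent_var K j) = u j.
Proof.
rewrite laurent_varE laurent_morph_monomial /monomial_eval (bigD1 j) //= big1.
  by rewrite ffunE eqxx mulr1.
by move=> i /negbTE ij; rewrite ffunE ij.
Qed.

End LaurentEvaluation.

Lemma monomial_expV (K : comNzRingType) (I : finType) (j : I) :
  monomial K (- exponent j) * laurent_var K j = 1.
Proof. by rewrite laurent_varE -monomialD addNr monomial0. Qed.

(** Inverses are unique, so two morphisms that agree on the variables also agree on the inverses of
    the variables, and [laurent_ind] applies. *)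
Lemma laurent_morph_ext (K : comNzRingType) (I : finType) (B : comAlgType K)
    (f g : {lrmorphism laurent K I -> B}) :
  (forall j, f (laurent_var K j) = g (laurent_var K j)) -> f =1 g.
Proof.
move=> fg; apply: (@laurent_ind K I (fun p => f p = g p))
  => [|p q IHp IHq|c p IHp|j p IHp|j p IHp].
- by rewrite !rmorph1.
- by rewrite !rmorphD /= IHp IHq.
- by rewrite !linearZ /= IHp.
- by rewrite !rmorphM /= IHp -laurent_varE fg.
rewrite !rmorphM /= IHp; congr (_ * _).
have inv (h : {lrmorphism laurent K I -> B}) :
    h (monomial K (- exponent j)) * h (laurent_var K j) = 1.
  by rewrite -rmorphM monomial_expV rmorph1.
have fi := inv f; have gi := inv g; rewrite /= fg in fi.
by rewrite -[LHS]mulr1 -[in LHS]gi mulrCA fi mulr1.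
Qed.

(** * The morphism induced on the quotient by a kernel *)

Section QuotientMorphism.
Variables (K : comNzRingType) (A : comAlgType K) (I : idealr A) (B : comAlgType K).
Variable phi : {lrmorphism A -> B}.
Hypothesis kerE : forall p, phi p = 0 <-> p \in I.

Definition quot_morph (x : {ideal_quot I}) : B := phi (repr x).

Lemma quot_morph_pi p : quot_morph (\pi p) = phi p.
Proof.
apply/eqP; rewrite -subr_eq0 -rmorphB; apply/eqP/kerE.
by rewrite Quotient.idealrBE reprK.
Qed.

Fact quot_morph_additive : additive quot_morph.
Proof.
move=> x y; rewrite -[x]reprK -[y]reprK -rmorphB !quot_morph_pi.
exact: rmorphB.
Qed.

Fact quot_morph_scalable : scalable quot_morph.
Proof.
move=> c x; have -> : c *: x = \pi_{ideal_quot I} (c *: repr x) by rewrite pi_scale reprK.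
by rewrite quot_morph_pi linearZ.
Qed.

Fact quot_morph_monoid_morphism : monoid_morphism quot_morph.
Proof.
split; first by rewrite -(rmorph1 (\pi_{ideal_quot I})) quot_morph_pi rmorph1.
move=> x y; rewrite -[x]reprK -[y]reprK -rmorphM !quot_morph_pi.
exact: rmorphM.
Qed.

HB.instance Definition _ := GRing.isAdditive.Build {ideal_quot I} B quot_morph
  quot_morph_additive.
HB.instance Definition _ := GRing.isScalable.Build K {ideal_quot I} B *:%R quot_morph
  quot_morph_scalable.
HB.instance Definition _ := GRing.isMonoidMorphism.Build {ideal_quot I} B quot_morph
  quot_morph_monoid_morphism.

Definition quot_lrmorph : {lrmorphism {ideal_quot I} -> B} := quot_morph.

(** The inverse sends [f] to the class of a chosen preimage; two preimages differ by an element of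
    the kernel [I]. *)
Lemma quot_morph_bij : (forall f, exists p, phi p = f) -> bijective quot_morph.
Proof.
move=> /choice[g gK]; exists (fun f => \pi_{ideal_quot I} (g f)) => [x|f]; last first.
  by rewrite quot_morph_pi.
rewrite -[x]reprK quot_morph_pi; apply/eqP.
rewrite -Quotient.idealrBE; apply/kerE; rewrite rmorphB /=.
by rewrite gK subrr.
Qed.

End QuotientMorphism.

(** * Integer boxes and their Minkowski products *)

Section BoxElements.
Variables (R : realType) (d : nat).
Local Notation W := 'rV[R]_d.
Local Notation C := R[i].
Local Notation M := (minkowski_ring (boxes R d)).
Implicit Types (a b : 'I_d -> int) (m n : 'I_d -> nat).

Lemma box_is_polyhedral a b : polyhedral (@box R d a b).
Proof. exact: polyhedral_box. Qed.

Definition box_polyhedron a b := Polyhedron (box_is_polyhedral a b).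

Lemma box_polyhedron_in_boxes a n :
  boxes R d (box_polyhedron a (fun i => a i + (n i)%:Z)).
Proof. by exists a, (fun i => a i + (n i)%:Z); split=> // i; rewrite lerDl. Qed.

Fact pind_box_in a n :
  pind (box_polyhedron a (fun i => a i + (n i)%:Z)) \in
    generated_subalg (@pind R d @` boxes R d).
Proof.
apply/asboolP => S _; apply; exists (box_polyhedron a (fun i => a i + (n i)%:Z)) => //.
exact: box_polyhedron_in_boxes.
Qed.

(** A box is encoded by its lower corner and its natural side lengths: it is then never empty, and a
    product of boxes adds both data. *)
Definition box_elt a n : M := MinkowskiElt (pind_box_in a n).

Lemma box_eltE a n x : box_elt a n x =
  \prod_i (if (a i)%:~R <= x 0 i <= (a i + (n i)%:Z)%:~R then 1 else 0 : C).
Proof.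
rewrite /box_elt /= indicE.
case: (boolP (x \in _)) => [|/negP xab].
  rewrite inE => xab; rewrite big1 // => i _.
  by rewrite xab.
have /existsNP[i /negP/negbTE xi] :
    ~ forall i, (a i)%:~R <= x 0 i <= (a i + (n i)%:Z)%:~R.
  by move=> H; apply: xab; rewrite inE.
by rewrite (bigD1 i) //= xi mul0r.
Qed.

(** For boxes lying on the [i]-th axis the factor off the axis is common to all, so identities
    between them reduce to dimension one. *)
Lemma box_elt_axis i a n x :
  (forall j, j != i -> a j = 0) -> (forall j, j != i -> n j = 0%N) ->
  box_elt a n x =
  (if (a i)%:~R <= x 0 i <= (a i + (n i)%:Z)%:~R then 1 else 0) *
  \prod_(j | j != i) (if 0 <= x 0 j <= 0 then 1 else 0).
Proof.
move=> a0 n0; rewrite box_eltE (bigD1 i) //=; congr (_ * _).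
by apply: eq_bigr => j ji; rewrite a0 // n0 // addr0.
Qed.

Lemma box_elt1 : box_elt (fun=> 0) (fun=> 0%N) = 1.
Proof.
apply/val_inj/pind_eq/seteqP; split=> [x /= x0|_ -> i]; last by rewrite !mxE lexx.
by apply/rowP => i; rewrite mxE; apply/esym/le_anti; have := x0 i; rewrite addr0.
Qed.

Lemma box_eltM a b m n : box_elt a m * box_elt b n =
  box_elt (fun i => a i + b i) (fun i => (m i + n i)%N).
Proof.
apply: val_inj; rewrite [LHS]pindM; apply/pind_eq/seteqP;
  split=> [_ [x xa [y yb <-]] i|x xab].
  rewrite mxE PoszD addrACA 2!rmorphD /=.
  have /andP[? ?] := xa i; have /andP[? ?] := yb i.
  by rewrite !lerD.
(* Each coordinate of the first summand is taken as large as possible: at most the upper end of the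
   first box, and leaving at least [b i] for the second. *)
pose y : W := \row_i Num.min ((a i + (m i)%:Z)%:~R) (x 0 i - (b i)%:~R).
have m0 i : 0 <= (m i)%:~R :> R by rewrite ler0n.
have n0 i : 0 <= (n i)%:~R :> R by rewrite ler0n.
apply/minkowski_sumP; exists y; split=> i; move: (xab i) (m0 i) (n0 i);
  rewrite !mxE PoszD !rmorphD /=;
  by have [] := leP ((a i)%:~R + (m i)%:~R) (x 0 i - (b i)%:~R); lra.
Qed.

Lemma box_elt_prod (J : Type) (r : seq J) (a : J -> 'I_d -> int) (n : J -> 'I_d -> nat) :
  \prod_(j <- r) box_elt (a j) (n j) =
  box_elt (fun i => \sum_(j <- r) a j i) (fun i => (\sum_(j <- r) n j i)%N).
Proof.
elim: r => [|j r IHr].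
  by rewrite big_nil -box_elt1; congr box_elt; apply/funext => i; rewrite big_nil.
by rewrite big_cons IHr box_eltM; congr box_elt; apply/funext => i; rewrite big_cons.
Qed.

Lemma box_eltX a m k : box_elt a m ^+ k =
  box_elt (fun i => a i *+ k) (fun i => (m i * k)%N).
Proof.
elim: k => [|k IHk].
  by rewrite expr0 -box_elt1; congr box_elt; apply/funext => i; rewrite ?muln0.
by rewrite exprS IHk box_eltM; congr box_elt; apply/funext => i; rewrite ?mulrS ?mulnS.
Qed.
End BoxElements.

(** The relation reads [y * (1 + x - y) = x], so [y] divides the unit [x]. *)
Lemma inverse_of_quadratic (A : comNzRingType) (x x' y : A) :
  x * x' = 1 -> y * y + x = y + x * y -> y * (x' * (1 + x - y)) = 1.
Proof.
move=> xx' rel; have -> : y * (x' * (1 + x - y)) = x' * (y + x * y - y * y) by ring.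
by rewrite -rel addrAC subrr add0r mulrC.
Qed.

(** * The morphism from Laurent polynomials and its surjectivity *)

Section BoxGenerators.
Variables (R : realType) (d : nat).
Local Notation W := 'rV[R]_d.
Local Notation C := R[i].
Local Notation M := (minkowski_ring (boxes R d)).
Local Notation box_elt := (@box_elt R d).
Implicit Types (i j : 'I_d).

Definition box_x i : M := box_elt (fun j => Posz (j == i)) (fun=> 0%N).
Definition box_xV i : M := box_elt (fun j => - Posz (j == i)) (fun=> 0%N).
Definition box_y i : M := box_elt (fun=> 0) (fun j => nat_of_bool (j == i)).
(** This is minus the indicator of the open segment from $-\tilde e_i$ to 0, in accordance with
    $[P]^{-1}=(-1)^{\dim P}[-\mathring P]$. *)
Definition box_yV i : M := box_xV i * (1 + box_x i - box_y i).

Lemma minkowski_ringP (f g : M) : (forall x : W, f x = g x) -> f = g.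
Proof. by move=> fg; do 2!apply: val_inj; apply/funext. Qed.

Lemma minkowski_addE (f g : M) (x : W) : (f + g : M) x = f x + g x.
Proof. by []. Qed.

Lemma minkowski_scaleE (c : C) (f : M) (x : W) : (c *: f : M) x = c * f x.
Proof. by []. Qed.

Lemma minkowski_sumE (J : Type) (r : seq J) (F : J -> M) (x : W) :
  (\sum_(j <- r) F j : M) x = \sum_(j <- r) F j x.
Proof. by elim/big_rec2: _ => //= j c f _ <-. Qed.

Lemma box_xK i : box_x i * box_xV i = 1.
Proof.
rewrite box_eltM -box_elt1; congr box_elt; apply/funext => j.
by rewrite subrr.
Qed.

(* [0,2e] + [e] = [0,e] + [e,2e], as indicator functions. *)
Lemma box_xy_relation i : box_y i * box_y i + box_x i = box_y i + box_x i * box_y i.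
Proof.
rewrite !box_eltM; apply: minkowski_ringP => x; rewrite !minkowski_addE.
rewrite !(box_elt_axis (i := i)) /=; try by move=> j /negbTE ji; rewrite ?ji ?addr0.
rewrite -!mulrDl; congr (_ * _).
rewrite !eqxx !(addr0, add0r, add0n) /= !(mulr0z, mulr1z) -[2%:~R]/(2%:R).
do !case: ifP => ? //=; rewrite ?addr0 ?add0r //; exfalso; lra.
Qed.

Lemma box_yK i : box_y i * box_yV i = 1.
Proof. exact: inverse_of_quadratic (box_xK i) (box_xy_relation i).
Qed.

Definition box_var (k : 'I_d + 'I_d) : M :=
  match k with inl i => box_x i | inr i => box_y i end.
Definition box_varV (k : 'I_d + 'I_d) : M :=
  match k with inl i => box_xV i | inr i => box_yV i end.

Lemma box_varK k : box_var k * box_varV k = 1.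
Proof. by case: k => i; [exact: box_xK | exact: box_yK]. Qed.

(* Locked so that simplification does not expand it into [laurent_eval]. *)
Definition box_morph : {lrmorphism laurent_xy R d -> M} :=
  locked (laurent_morph box_varK).

Lemma box_morph_x i : box_morph (var_x R i) = box_x i.
Proof. by rewrite /box_morph -lock [LHS](laurent_morph_var box_varK). Qed.

Lemma box_morph_y i : box_morph (var_y R i) = box_y i.
Proof. by rewrite /box_morph -lock [LHS](laurent_morph_var box_varK). Qed.

(** The exponents of the [y] variables are natural because they become side lengths: these monomials
    are exactly the ones sent to boxes by [box_morph_monomial]. *)
Definition xy_exponent (m : {ffun 'I_d -> int}) (n : 'I_d -> nat) :
    {ffun 'I_d + 'I_d -> int} :=
  [ffun j => match j with inl i => m i | inr i => Posz (n i) end].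

Lemma zpow_box_x i (z : int) : zpow (box_x i) (box_xV i) z =
  box_elt (fun j => Posz (j == i) * z) (fun=> 0%N).
Proof.
case: z => n /=; rewrite box_eltX; congr box_elt; apply/funext => j.
  by rewrite -mulr_natr natz.
by rewrite NegzE mulrN -mulNr -mulr_natr natz.
Qed.

Lemma box_morph_monomial m n :
  box_morph (monomial C (xy_exponent m n)) = box_elt m n.
Proof.
rewrite /box_morph -lock [LHS]laurent_morph_monomial /monomial_eval big_sumType /=.
under eq_bigr do rewrite ffunE zpow_box_x.
under [X in _ * X]eq_bigr do rewrite ffunE /= box_eltX.
rewrite !box_elt_prod box_eltM; congr box_elt; apply/funext => j.
  rewrite [X in _ + X]big1 => [|i _]; last by rewrite mul0rn.
  rewrite addr0 (bigD1 j) //= eqxx mul1r big1 ?addr0 // => i ij.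
  by rewrite eq_sym (negbTE ij) mul0r.
rewrite big1 // add0n (bigD1 j) //= eqxx mul1n big1 ?addn0 // => i ij.
by rewrite eq_sym (negbTE ij).
Qed.

Lemma axis_proj_cube i : axis_proj i @` unit_cube R d =
  box (fun=> 0) (fun j => Posz (j == i)).
Proof.
apply/seteqP; split=> [_ [x xc <-] j|x xb].
  rewrite /axis_proj !mxE eqxx /=.
  by case: eqP => [_|_]; rewrite ?mulr1 ?mulr0 ?lexx // xc.
(* A point of the segment lies in the cube and is fixed by the projection. *)
exists x => [j|].
  have := xb j; case: (j == i) => //= /andP[-> /le_trans->] //.
apply/rowP => j; rewrite /axis_proj !mxE eqxx /=.
have := xb j; have [->|ji /=] := eqVneq j i; rewrite ?mulr1 ?mulr0 //.
by move/le_anti.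
Qed.

Lemma box_morph_values : box_values box_morph.
Proof.
split=> i.
  rewrite box_morph_x /=; congr (\1__); apply/seteqP; split=> [x xb|_ ->] /=.
    apply/rowP => j; rewrite mxE eqxx /=.
    by have := xb j; rewrite addr0 => /le_anti <-.
  by move=> j; rewrite mxE eqxx addr0 lexx.
by rewrite box_morph_y /= axis_proj_cube; congr (\1_(box _ _)).
Qed.

Lemma box_values_ext (phi psi : {lrmorphism laurent_xy R d -> M}) :
  box_values phi -> box_values psi -> psi =1 phi.
Proof.
move=> [phix phiy] [psix psiy]; apply: laurent_morph_ext => -[] i.
  by apply: minkowski_ringP => x; rewrite [LHS](congr1 (@^~ x) (psix i)) -(phix i).
by apply: minkowski_ringP => x; rewrite [LHS](congr1 (@^~ x) (psiy i)) -(phiy i).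
Qed.

Lemma box_morph_surj (f : M) : exists p, box_morph p = f.
Proof.
suff [p pf] : exists p, minkowski_val (box_morph p) = minkowski_val f.
  by exists p; exact: val_inj.
have /asboolP H := minkowski_valP f.
(* The image is viewed inside the ring of all polyhedral functions, where generation is defined; it
   is a subalgebra, so it suffices that it contains the boxes. *)
pose S : {pred polyhedral_fun R d} :=
  fun g => `[< exists p, minkowski_val (box_morph p) = g >].
suff : minkowski_val f \in S by move/asboolP.
apply: H => [|_ [P [a [b [ab PE]]] <-]].
  split=> [|c g h /asboolP[p pg] /asboolP[q qh]|g h /asboolP[p pg] /asboolP[q qh]];
    apply/asboolP.
  - by exists 1; rewrite rmorph1.
  - by exists (c *: p + q); rewrite linearP /= -pg -qh.
  - by exists (p * q); rewrite rmorphM /= -pg -qh.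
apply/asboolP.
(* The box with corners [a] and [b] is the image of $x^a y^{b-a}$. *)
exists (monomial C (xy_exponent [ffun i => a i] (fun i => `|b i - a i|%N))).
rewrite box_morph_monomial; apply: pind_eq; rewrite PE; congr box.
  by apply/funext => i; rewrite ffunE.
by apply/funext => i; rewrite ffunE gez0_abs ?subr_ge0 // [LHS]addrC subrK.
Qed.
End BoxGenerators.

(** * Cell monomials and their linear independence *)

Section NormalForms.
Variables (R : realType) (d : nat).
Local Notation W := 'rV[R]_d.
Local Notation C := R[i].
Local Notation M := (minkowski_ring (boxes R d)).
Local Notation A := (laurent_xy R d).
Implicit Types (i : 'I_d).

(* The cell (m, S) is the product over i of the open interval ]m i, m i + 1[
   if i is in S, and of the point m i otherwise. *)
Definition cell : choiceType := ({ffun 'I_d -> int} * {set 'I_d})%type.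

Definition var_z i : A := var_y R i - 1 - var_x R i.

Definition cell_monomial (t : cell) : A :=
  monomial C (xy_exponent t.1 (fun=> 0%N)) * \prod_(i in t.2) var_z i.

(** The barycenter of the cell. Each center lies in exactly one cell, so evaluations at centers form
    a family dual to the cell indicators. *)
Definition cell_center (t : cell) : W :=
  \row_i ((t.1 i)%:~R + (i \in t.2)%:R / 2).

(* The indicator of ]0, 1[ (if s) or of {0} (otherwise) as a combination of
   those of [0, 1], {0} and {1}, numbered 0, 1, 2. *)
Definition edge_coef (s : bool) (k : 'I_3) : C :=
  if s then (if k == 0 :> nat then 1 else -1) else (k == 1 :> nat)%:R.

(** The one-dimensional case: the indicator of the cell [(m, s)] of the line, evaluated at the
    center of the cell [(m', s')]. *)
Lemma edge_sum (m m' : int) (s s' : bool) :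
  \sum_k edge_coef s k *
    (if (m + (k == 2 :> nat)%:Z)%:~R <= (m'%:~R + s'%:R / 2 : R)
        <= (m + (k == 2 :> nat)%:Z + (k == 0 :> nat)%:Z)%:~R then 1 else 0) =
  ((m == m') && (s == s'))%:R.
Proof.
(* Comparing an integer with a half-integer amounts to comparing it with the floor ([le1]) or the
   ceiling ([le2]), which leaves only integer inequalities. *)
have le1 (a : int) : (a%:~R <= (m'%:~R + s'%:R / 2 : R)) = (a <= m').
  case: s' => /=; rewrite ?mulr0n ?mulr1n ?mul0r ?addr0 ?ler_int //;
    apply/idP/idP => H.
    have : a%:~R < ((m' + 1)%:~R : R) by rewrite rmorphD /=; lra.
    by rewrite ltr_int ltzD1.
  have : a%:~R <= (m'%:~R : R) by rewrite ler_int.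
  lra.
have le2 (a : int) : ((m'%:~R + s'%:R / 2 : R) <= a%:~R) = (m' + s'%:Z <= a).
  case: s' {le1} => /=; rewrite ?mulr0n ?mulr1n ?mul0r ?addr0 ?ler_int //;
    apply/idP/idP => H.
    have : m'%:~R < (a%:~R : R) by lra.
    by rewrite ltr_int lezD1.
  have : (m' + 1)%:~R <= (a%:~R : R) by rewrite ler_int.
  rewrite rmorphD /=; lra.
rewrite !big_ord_recl big_ord0 /edge_coef !le1 !le2 /= !addr0.
case: s; case: s' {le1 le2}; have [?|?] := eqVneq m m'; do !case: ifP => ?;
  rewrite ?(mulr0, mulr1, mul0r, mul1r, mulN1r, oppr0, addr0, add0r, subrr) //=;
  exfalso; lia.
Qed.

Lemma box_morph_z i :
  box_morph R d (var_z i) = box_y R i - 1 - box_x R i.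
Proof. by rewrite /var_z !rmorphB rmorph1 /= box_morph_x box_morph_y. Qed.

(** The ring product is not pointwise, so evaluation at [x] is not multiplicative. The monomial is
    first expanded into boxes, one for each choice [f] of a face in every direction; the value of a
    box is a product over the coordinates, and distributivity regroups the sum. *)
Lemma box_morph_cell (t : cell) (x : W) :
  box_morph R d (cell_monomial t) x =
  \prod_i \sum_k edge_coef (i \in t.2) k *
    (if (t.1 i + (k == 2 :> nat)%:Z)%:~R <= x 0 i
        <= (t.1 i + (k == 2 :> nat)%:Z + (k == 0 :> nat)%:Z)%:~R then 1 else 0).
Proof.
case: t => m S /=.
(* The segment from 0 to $\tilde e_i$, the origin and the point $\tilde e_i$, numbered as in
   [edge_coef]. *)
pose E (i : 'I_d) (k : 'I_3) : M := box_elt R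
  (fun j => ((j == i) && (k == 2 :> nat) : nat)%:Z)
  (fun j => ((j == i) && (k == 0 :> nat) : nat)).
have zE i : (if i \in S then box_y R i - 1 - box_x R i else 1) =
    \sum_k edge_coef (i \in S) k *: E i k.
  have E0 : E i 0 = box_y R i.
    by congr box_elt; apply/funext => j; rewrite ?andbF ?andbT.
  have E1 : E i 1 = 1.
    by rewrite -box_elt1; congr box_elt; apply/funext => j; rewrite ?andbF ?andbT.
  have E2 : E i (inord 2) = box_x R i.
    by congr box_elt; apply/funext => j; rewrite ?inordK ?andbF ?andbT.
  rewrite !big_ord_recl big_ord0 addr0 /edge_coef /=.
  rewrite -[ord0]/(0 : 'I_3) E0 (_ : lift ord0 ord0 = 1 :> 'I_3); last exact/val_inj.
  rewrite E1 (_ : lift ord0 _ = inord 2 :> 'I_3);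
    last by apply/val_inj; rewrite /= inordK.
  rewrite E2; case: (i \in S); first by rewrite scale1r !scaleN1r addrA.
  by rewrite !scale0r scale1r add0r addr0.
have -> : box_morph R d (cell_monomial (m, S)) =
    \sum_(f : {ffun 'I_d -> 'I_3}) (\prod_i edge_coef (i \in S) (f i)) *:
      box_elt R (fun i => m i + (f i == 2 :> nat)%:Z) (fun i => (f i == 0 :> nat)%N).
  rewrite /cell_monomial /= rmorphM rmorph_prod /= box_morph_monomial.
  under eq_bigr do rewrite box_morph_z.
  rewrite big_mkcond /=; under eq_bigr do rewrite zE.
  rewrite (bigA_distr_bigA (fun i k => edge_coef (i \in S) k *: E i k)) mulr_sumr.
  apply: eq_bigr => f _.
  rewrite scaler_prod -scalerAr box_elt_prod box_eltM; congr (_ *: _).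
  congr box_elt; apply/funext => i.
    rewrite (bigD1 i) //= eqxx big1 ?addr0 // => j /negbTE ji.
    by rewrite eq_sym ji.
  rewrite (bigD1 i) //= eqxx big1 ?addn0 ?add0n // => j /negbTE ji.
  by rewrite eq_sym ji.
rewrite minkowski_sumE bigA_distr_bigA; apply: eq_bigr => f _.
by rewrite minkowski_scaleE box_eltE -big_split.
Qed.

Lemma box_morph_cell_center (t t' : cell) :
  box_morph R d (cell_monomial t) (cell_center t') = (t == t')%:R.
Proof.
rewrite box_morph_cell.
under eq_bigr do rewrite mxE edge_sum.
case: t t' => m S [m' S'] /=.
have [[-> ->]|ne] := eqVneq (m, S) (m', S').
  by rewrite big1 // => i _; rewrite !eqxx.
suff /existsNP[i /negP/negbTE H] :
    ~ forall i, (m i == m' i) && ((i \in S) == (i \in S')).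
  by rewrite (bigD1 i) //= H mul0r.
move=> H; case/eqP: ne; congr (_, _); [apply/ffunP => i|apply/setP => i];
  by have /andP[/eqP ? /eqP ?] := H i.
Qed.

Definition cell_comb (q : {malg C[cell]}) : A := mmap (in_alg A) cell_monomial q.

(** Values at the centers recover all coefficients, so the images of the cell monomials are linearly
    independent. *)
Lemma box_morph_cell_comb q t :
  box_morph R d (cell_comb q) (cell_center t) = mcoeff t q.
Proof.
have -> : box_morph R d (cell_comb q) =
    \sum_(t' <- msupp q) mcoeff t' q *: box_morph R d (cell_monomial t').
  rewrite /cell_comb mmapE rmorph_sum; apply: eq_bigr => t' _.
  by rewrite mulr_algl /= linearZ.
rewrite minkowski_sumE [in RHS](monalgE q) raddf_sum; apply: eq_bigr => t' _.
by rewrite minkowski_scaleE box_morph_cell_center /= mcoeffU mulr_natr.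
Qed.

End NormalForms.

(** * Linear span of a family modulo an ideal *)

Section SpanModuloIdeal.
Variables (K : comNzRingType) (T : choiceType) (A : comAlgType K) (I : idealr A).
Variable e : T -> A.
Implicit Types (p q r : A) (t : T).

Definition span_mod p : Prop :=
  exists s : {malg K[T]}, p - mmap (in_alg A) e s \in I.

Lemma span_mod_gen t : span_mod (e t).
Proof. by exists (mkmalgU t 1); rewrite mmap_in_algU scale1r subrr rpred0. Qed.

Lemma span_modD p q : span_mod p -> span_mod q -> span_mod (p + q).
Proof. by move=> [s ps] [t qt]; exists (s + t); rewrite mmapD opprD addrACA rpredD. Qed.

Lemma span_modZ c p : span_mod p -> span_mod (c *: p).
Proof.
move=> [s ps]; exists (c *: s).
by rewrite mmap_in_algZ -scalerBr -mulr_algl idealMr.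
Qed.

Lemma span_modN p : span_mod p -> span_mod (- p).
Proof. by rewrite -scaleN1r; exact: span_modZ. Qed.

Lemma span_mod_sum (J : Type) (s : seq J) (F : J -> A) :
  (forall j, span_mod (F j)) -> span_mod (\sum_(j <- s) F j).
Proof.
move=> FN; elim/big_rec: _ => [|j p _]; last exact: span_modD.
by exists 0; rewrite mmap0 subr0 rpred0.
Qed.

Lemma span_mod_congr p q : p - q \in I -> span_mod q -> span_mod p.
Proof. by move=> pq [s qs]; exists s; rewrite -(subrKA q) rpredD. Qed.

(** Multiplication by [r] is linear and preserves the ideal, so stability of the span has only to be
    tested on the family. *)
Lemma span_modM r : (forall t, span_mod (e t * r)) ->
  forall p, span_mod p -> span_mod (p * r).
Proof.
move=> Nr p [s ps]; apply: (@span_mod_congr _ (mmap (in_alg A) e s * r)).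
  by rewrite -mulrBl mulrC idealMr.
rewrite mmapE mulr_suml; apply: span_mod_sum => t.
by rewrite mulr_algl -scalerAl; exact: span_modZ.
Qed.

End SpanModuloIdeal.

(** * Reduction to cell monomials and the kernel *)

Section NormalFormExistence.
Variables (R : realType) (d : nat).
Local Notation C := R[i].
Local Notation A := (laurent_xy R d).
Implicit Types (i j : 'I_d) (p q r : A) (t : cell d).

Local Notation has_cell_form := (span_mod (box_ideal R d) (@cell_monomial R d)).

Lemma cell_monomial_shift t (k : {ffun 'I_d -> int}) :
  cell_monomial R t * monomial C (xy_exponent k (fun=> 0%N)) =
  cell_monomial R (t.1 + k, t.2).
Proof.
rewrite /cell_monomial mulrAC -monomialD; congr (monomial C _ * _).
by apply/ffunP => -[] j; rewrite !ffunE /=.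
Qed.

(** Cells may be translated by any integer vector, so a variable [x] and its inverse are treated
    alike. *)
Lemma cell_formM_x i (k : {ffun 'I_d + 'I_d -> int}) p :
  k = exponent (inl i) \/ k = - exponent (inl i) ->
  has_cell_form p -> has_cell_form (p * monomial C k).
Proof.
move=> kE; have -> : k = xy_exponent [ffun j => k (inl j)] (fun=> 0%N).
  by case: kE => ->; apply/ffunP => -[] j; rewrite !ffunE.
by apply: span_modM => t; rewrite cell_monomial_shift; exact: span_mod_gen.
Qed.

Lemma mulrA_swap (B : comNzRingType) (a b c : B) : a * b * c = a * (c * b).
Proof. by rewrite -mulrA (mulrC b). Qed.

Lemma factored_quadratic (B : comNzRingType) (x y : B) :
  y * y + x = y + x * y -> (y - 1) * (y - x) = 0.
Proof.
move=> rel; have -> : (y - 1) * (y - x) = (y * y + x) - (y + x * y) by ring.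
by rewrite rel subrr.
Qed.

(** With z = y - 1 - x the relation becomes (z + x)(z + 1) = 0, which rewrites z^2 as -(z + zx +
    x). *)
Lemma shifted_quadratic (B : comNzRingType) (a x y : B) :
  a * (y - 1 - x) * (y - 1 - x) - (- (a * (y - 1 - x) + a * (y - 1 - x) * x + a * x)) =
  a * ((y - 1) * (y - x)).
Proof. ring. Qed.

(** Modulo the relation, y^{-1} = -x^{-1}z with z = y - 1 - x. *)
Lemma shifted_inverse (B : comNzRingType) (p x x' y y' : B) :
  x' * x = 1 -> y' * y = 1 ->
  p * y' - - (p * x' * (y - 1 - x)) = p * y' * x' * ((y - 1) * (y - x)).
Proof.
move=> xx yy.
(* Factors [x' * x] and [y' * y] are inserted to get an identity valid in every commutative ring;
   the correction terms vanish by the hypotheses. *)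
have -> : p * y' - - (p * x' * (y - 1 - x)) =
  p * y' * (x' * x) + p * x' * (y' * y) * (y - 1 - x) +
  (p * y' * (1 - x' * x) + p * x' * (1 - y' * y) * (y - 1 - x)) by ring.
rewrite xx yy !subrr !mulr0 mul0r !addr0.
have -> : p * y' * x' * ((y - 1) * (y - x)) =
  p * y' * (x' * x) + p * x' * (y' * y) * (y - 1 - x) by ring.
by rewrite xx yy.
Qed.

Lemma box_relation_in i r : r * box_relation R i \in box_ideal R d.
Proof.
apply: idealMr; apply/asboolP; exists (fun j => (j == i)%:R).
rewrite (bigD1 i) //= eqxx mul1r big1 ?addr0 // => j /negbTE ->.
by rewrite mul0r.
Qed.

Lemma var_xE i : var_x R i = monomial C (exponent (inl i)).
Proof. exact: laurent_varE. Qed.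

Lemma cell_formM_var_x i p : has_cell_form p -> has_cell_form (p * var_x R i).
Proof. by rewrite var_xE; apply: (@cell_formM_x i); left. Qed.

(** If [i] is not in [S], the new factor enlarges [S]; otherwise a square appears and
    [shifted_quadratic] lowers its degree. *)
Lemma cell_formM_z i p : has_cell_form p -> has_cell_form (p * var_z R i).
Proof.
apply: span_modM => -[m S]; have [iS|iS] := boolP (i \in S); last first.
  have -> : cell_monomial R (m, S) * var_z R i = cell_monomial R (m, i |: S).
    by rewrite [RHS]/cell_monomial (big_setU1 _ iS); exact: mulrA_swap.
  exact: span_mod_gen.
pose a := cell_monomial R (m, S :\ i).
have aE : cell_monomial R (m, S) = a * var_z R i.
  by rewrite [LHS]/cell_monomial (big_setD1 i iS); exact/esym/mulrA_swap.
have Na : has_cell_form a by exact: span_mod_gen.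
have Naz : has_cell_form (a * var_z R i) by rewrite -aE; exact: span_mod_gen.
rewrite aE; apply: (@span_mod_congr _ _ _ _ _ _
  (- (a * var_z R i + a * var_z R i * var_x R i + a * var_x R i))).
  by rewrite [X in X \in _]shifted_quadratic; exact: box_relation_in.
exact (span_modN (span_modD (span_modD Naz (cell_formM_var_x i Naz))
  (cell_formM_var_x i Na))).
Qed.

Lemma cell_formM_y i p : has_cell_form p -> has_cell_form (p * var_y R i).
Proof.
move=> Np; have -> : var_y R i = var_z R i + 1 + var_x R i.
  by rewrite /var_z addrAC !subrK.
rewrite mulrDr (mulrDr p (var_z R i)) mulr1.
exact (span_modD (span_modD (cell_formM_z i Np) Np) (cell_formM_var_x i Np)).
Qed.

Lemma cell_formM_yV i p : has_cell_form p ->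
  has_cell_form (p * monomial C (- exponent (inr i))).
Proof.
move=> Np; apply: (@span_mod_congr _ _ _ _ _ _
  (- (p * monomial C (- exponent (inl i)) * var_z R i))).
  rewrite (@shifted_inverse _ p (var_x R i) _ (var_y R i)); try exact: monomial_expV.
  exact: box_relation_in.
exact (span_modN (cell_formM_z i (cell_formM_x (or_intror erefl) Np))).
Qed.

(** The unit is the cell monomial of the origin, and cell forms are stable under multiplication by
    all variables and their inverses. *)
Lemma cell_form_exists p : has_cell_form p.
Proof.
move: p; apply: laurent_ind => [|p q|c p|[i|i] p|[i|i] p].
- have -> : 1 = cell_monomial R (0, finset.set0) :> A.
    rewrite /cell_monomial big_set0 mulr1 -(monomial0 C ('I_d + 'I_d)%type).
    by congr monomial; apply/ffunP => -[] j; rewrite !ffunE.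
  exact: span_mod_gen.
- exact: span_modD.
- exact: span_modZ.
- by apply: (@cell_formM_x i); left.
- rewrite -laurent_varE; exact: cell_formM_y.
- by apply: (@cell_formM_x i); right.
- exact: cell_formM_yV.
Qed.

Lemma box_morph_relation i : box_morph R d (box_relation R i) = 0.
Proof.
rewrite /box_relation rmorphM !rmorphB rmorph1 /= box_morph_x box_morph_y.
exact: factored_quadratic (box_xy_relation R i).
Qed.

(** An element of the kernel is congruent modulo the ideal to a cell combination whose image is also
    0; its coefficients, read off at the centers, all vanish. *)
Lemma box_morph_ker p : box_morph R d p = 0 <-> p \in box_ideal R d.
Proof.
have idealP r : r \in box_ideal R d -> box_morph R d r = 0.
  move/asboolP => [h ->]; rewrite rmorph_sum big1 // => i _.
  by rewrite rmorphM [X in _ * X]box_morph_relation mulr0.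
split; last exact: idealP.
move=> p0; have [q pq] := cell_form_exists p.
suff q0 : q = 0 by move: pq; rewrite q0 /cell_comb mmap0 subr0.
have := idealP _ pq; rewrite rmorphB /= p0 sub0r => /eqP.
rewrite oppr_eq0 => /eqP q0; apply/malgP => t.
by rewrite -box_morph_cell_comb q0 mcoeff0.
Qed.

End NormalFormExistence.

Theorem corollary3p13 (R : realType) (d : nat) (hd : (0 < d)%N) :
  exists phi : {lrmorphism laurent_xy R d -> minkowski_ring (boxes R d)},
    [/\ box_values phi,
        forall psi : {lrmorphism laurent_xy R d -> minkowski_ring (boxes R d)},
          box_values psi -> psi =1 phi,
        forall f : minkowski_ring (boxes R d), exists p, phi p = f,
        forall p : laurent_xy R d, phi p = 0 <-> p \in box_ideal R d
      & exists2 Phi : {lrmorphism {ideal_quot (box_ideal R d)} ->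
                                  minkowski_ring (boxes R d)},
          bijective Phi &
          forall p : laurent_xy R d, Phi (\pi_{ideal_quot (box_ideal R d)} p)%qT = phi p].
Proof.
exists (box_morph R d); split.
- exact: box_morph_values.
- by move=> psi; apply: box_values_ext; exact: box_morph_values.
- exact: box_morph_surj.
- exact: box_morph_ker.
exists (quot_lrmorph (@box_morph_ker R d)).
  exact: quot_morph_bij (@box_morph_ker R d) (@box_morph_surj R d).
exact: quot_morph_pi (@box_morph_ker R d).
Qed.
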